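(* Let $s\geq 18$ be an integer. For every integer $\lambda$ with $2\leq\lambda\leq 2\lfloor s/2\rfloor-1$ there exists a simple and indecomposable $1$-factorization of $\lambda K_{2s}$.
   Context: The complete multigraph $\lambda K_{2s}$ has $2s$ vertices, and each pair of distinct vertices is joined by exactly $\lambda$ edges. A $1$-factor of $\lambda K_{2s}$ is a spanning subgraph consisting of $s$ pairwise independent edges (a perfect matching); two $1$-factors are regarded as equal if they consist of the same unordered pairs of vertices. A $1$-factorization of $\lambda K_{2s}$ is a partition of the edge-(multi)set of $\lambda K_{2s}$ into $1$-factors, i.e. a multiset of $1$-factors such that every pair of distinct vertices is covered exactly $\lambda$ times, counting multiplicities. A $1$-factorization is simple if no $1$-factor is repeated in it. It is decomposable if it is the (multiset) union of a $1$-factorization of $\lambda_0K_{2s}$ and a $1$-factorization of $(\lambda-\lambda_0)K_{2s}$ for some integer $\lambda_0$ with $1\le\lambda_0<\lambda$; otherwise it is indecomposable. *)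

(* Defs.v *)
From mathcomp Require Import all_boot finmap multiset.
Set Implicit Arguments.
Unset Strict Implicit.
Unset Printing Implicit Defensive.

Local Open Scope mset_scope.
Local Open Scope nat_scope.

(* A finite type T stands for the vertex set; an edge is a 2-element set of
   vertices, and a 1-factor is identified with its set of edges. *)

Definition one_factor (T : finType) (F : {set {set T}}) : bool :=
  [forall e in F, #|e| == 2] && partition F [set: T].

(* [M F] is the multiplicity of [F] in the multiset [M], so the sum counts,
   with multiplicity, the members of [M] that contain the edge {x, y}. *)
Definition one_factorization (T : finType) (lambda : nat)
    (M : {mset {set {set T}}}) : Prop :=
  (forall F, F \in M -> one_factor F) /\
  (forall x y : T, x != y ->
     \sum_(F : {set {set T}} | [set x; y] \in F) M F = lambda).

Definition simple_factorization (T : finType)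
    (M : {mset {set {set T}}}) : Prop :=
  forall F, M F <= 1.

(* [`+`] adds multiplicities. *)
Definition decomposable (T : finType) (lambda : nat)
    (M : {mset {set {set T}}}) : Prop :=
  exists lambda0 : nat, 1 <= lambda0 < lambda /\
    exists M1 M2 : {mset {set {set T}}},
      [/\ one_factorization lambda0 M1,
          one_factorization (lambda - lambda0) M2
        & M = M1 `+` M2].

Definition indecomposable (T : finType) (lambda : nat)
    (M : {mset {set {set T}}}) : Prop :=
  ~ decomposable lambda M.

(* Main.v *)
Require Import Defs.
From mathcomp Require Import all_boot finmap multiset zify.
Set Implicit Arguments.
Unset Strict Implicit.
Unset Printing Implicit Defensive.

Local Open Scope mset_scope.
Local Open Scope nat_scope.

(** The vertices are written (i, y) with i in Z_s and y a layer in {0, 1}.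

    Suppose a 1-factorization of K_2s has three factors whose union has q
    connected components.  In lambda copies of it, the 3 lambda copies of these
    factors may be cut along the components and reassembled: a reassembled
    factor is a word of length q over {0, 1, 2}, whose letter at p says which of
    the three factors is used on the component p.  The edges of the three
    factors are again covered lambda times as soon as each letter occurs lambda
    times at each position ([factorization_of_words]).  A decomposition with
    parameter lambda0 selects a subfamily of the words in which each letter
    occurs lambda0 times at each position.  So what is needed is a family of
    3 lambda distinct words that is balanced and has no proper balanced
    subfamily ([indecomposable_words]), together with lambda copies of the other
    factors made pairwise distinct by exchanging layers.

    Words.  A family with repetitions is the datum of multiplicities and, at
    each position, of a partition of the words into three classes of total
    multiplicity lambda; it has no proper balanced subfamily when these
    equations leave one free parameter, worth 0 or 1.  Two words A and A' have
    multiplicity lambda - k, and a position is given by two disjoint sets Q and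
    Q' of total multiplicity k among the remaining words, with classes A + Q,
    A' + Q' and the rest.  So all sets Q have the same multiplicity in a balanced
    subfamily, and likewise all Q'.  For k = 5, the remaining words are five
    words of multiplicities 1, 1, 2, 2, 3, which five sets of total 5 determine
    up to a factor, and words of multiplicity 5, each of which is itself a Q or
    a Q' at some position; one more word, completed to a set of total 5 by some
    of the first five, adjusts lambda.  For lambda < 5, k = 1 serves.  About
    lambda / 5 positions are used in this way, and the other ones are free to
    tell equal words apart by base 3 digits ([words_of_columns], [words_large]).

    Factors.  For 0 < d < s/2, the edges between (i, y) and (i + d, z) form a
    4-regular graph, which splits into four factors whatever the parity of the
    cycles i, i + d, i + 2d, ... ([shift_factor]).  If s = 2R, the remaining edges
    form the R copies of K_4 on the vertices with i in {a, a + R}, hence three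
    factors with R components ([even_case]).  If s = 2R + 1, the differences
    d >= 2 are treated in this way, and the edges with d <= 1 are split into
    three factors preserving the sets {0, ..., 4}, {5, 6}, {7, 8}, ... of values
    of i, which is R - 1 components, and two other factors ([odd_case]).  In both
    cases lambda <= 2q + 1 and q >= 8, which suffices for the words
    ([exists_words]). *)

(** * Words without proper balanced subfamilies *)

(** The words are indexed by 0, ..., 3 lam - 1, and [w i p] is the letter of the
    i-th word at the position p.  In the last clause [y] is the indicator
    function of a subfamily. *)
Definition indecomposable_words (lam q : nat) (w : nat -> nat -> nat) : Prop :=
  [/\ forall i p, w i p < 3,
      forall p v, p < q -> v < 3 ->
        \sum_(0 <= i < 3 * lam | w i p == v) 1 = lam,
      forall i i', i < 3 * lam -> i' < 3 * lam ->
        (forall p, p < q -> w i p = w i' p) -> i = i'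
    & forall (y : nat -> nat) (lam0 : nat), (forall i, y i <= 1) ->
        (forall p v, p < q -> v < 3 ->
          \sum_(0 <= i < 3 * lam | w i p == v) y i = lam0) ->
        lam0 = 0 \/ lam0 = lam].

(** The letters at one position: the words below [a] are the copies of A, the
    next [a] ones those of A', and the remaining ones are numbered from 0. *)
Definition column (a : nat) (Q Q' : seq nat) (i : nat) : nat :=
  if i < a then 0 else
  if i < a + a then 1 else
  if i - (a + a) \in Q then 0 else
  if i - (a + a) \in Q' then 1 else 2.

Lemma sum_mem_seq (n : nat) (Q : seq nat) (y : nat -> nat) :
  uniq Q -> {in Q, forall o, o < n} ->
  \sum_(0 <= o < n | o \in Q) y o = \sum_(o <- Q) y o.
Proof.
move=> uQ ltQ; rewrite -big_filter; apply: perm_big.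
apply: uniq_perm => //; first by rewrite filter_uniq ?iota_uniq.
move=> o; rewrite mem_filter mem_index_iota /=.
by case oQ: (o \in Q) => //=; rewrite ltQ.
Qed.

Lemma sum_column a n Q Q' (y : nat -> nat) :
  uniq Q -> uniq Q' -> {in Q, forall o, o < n} -> {in Q', forall o, o < n} ->
  {in Q, forall o, o \notin Q'} ->
  \sum_(0 <= i < a + a + n | column a Q Q' i == 0) y i
    = \sum_(0 <= i < a) y i + \sum_(o <- Q) y (o + (a + a)) /\
  \sum_(0 <= i < a + a + n | column a Q Q' i == 1) y i
    = \sum_(a <= i < a + a) y i + \sum_(o <- Q') y (o + (a + a)).
Proof.
move=> uQ uQ' ltQ ltQ' dQ.
have split3 (P : pred nat) : \sum_(0 <= i < a + a + n | P i) y i =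
    \sum_(0 <= i < a | P i) y i + \sum_(a <= i < a + a | P i) y i
    + \sum_(0 <= o < n | P (o + (a + a))) y (o + (a + a)).
  rewrite (big_cat_nat (n := a + a)) //=; last lia.
  rewrite (big_cat_nat (n := a)) //=; last lia.
  congr (_ + _); have := @big_addn _ 0 addn 0 (a + a + n) (a + a) P y.
  by rewrite add0n; have -> : a + a + n - (a + a) = n by lia.
have z1 i : 0 <= i < a -> column a Q Q' i = 0.
  by move=> /andP[_ h]; rewrite /column h.
have z2 i : a <= i < a + a -> column a Q Q' i = 1.
  by move=> /andP[h h']; rewrite /column ltnNge h h'.
have z3 o : column a Q Q' (o + (a + a)) =
    if o \in Q then 0 else if o \in Q' then 1 else 2.
  rewrite /column addnK.
  have -> : (o + (a + a) < a) = false by lia.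
  by have -> : (o + (a + a) < a + a) = false by lia.
rewrite !split3; split.
- rewrite -(sum_mem_seq (fun o => y (o + (a + a))) uQ ltQ); congr (_ + _).
    rewrite [X in _ + X]big1_seq => [|i /andP[+ ]]; last first.
      by rewrite mem_index_iota => /eqP h /z2; rewrite h.
    rewrite addn0 big_nat_cond [RHS]big_nat_cond; apply: eq_bigl => i.
    by rewrite andbT; case h: (0 <= i < a) ; [rewrite (z1 _ h) | ].
  apply: eq_bigl => o; rewrite z3; by case: ifP => // _; case: ifP.
- rewrite -(sum_mem_seq (fun o => y (o + (a + a))) uQ' ltQ'); congr (_ + _).
    rewrite [X in X + _]big1_seq => [|i /andP[+ ]]; last first.
      by rewrite mem_index_iota => /eqP h /z1; rewrite h.
    rewrite add0n big_nat_cond [RHS]big_nat_cond; apply: eq_bigl => i.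
    by rewrite andbT; case h: (a <= i < a + a) ; [rewrite (z2 _ h) | ].
  apply: eq_bigl => o; rewrite z3; case: ifP => [/dQ /negbTE-> //|_]; by case: ifP.
Qed.

(** The base 3 digit of rank [j], shifted by [i] so that any three consecutive
    words starting at a multiple of 3 take the three values: the quotient is
    constant on them if [j] is positive, and [digit 0 i] is 2 i mod 3. *)
Definition digit (j i : nat) : nat := (i %/ 3 ^ j + i) %% 3.

Lemma digit_balanced lam j v : v < 3 ->
  \sum_(0 <= i < 3 * lam | digit j i == v) 1 = lam.
Proof.
move=> v3; rewrite big_mkcond /=; elim: lam => [|m IHm]; first by rewrite muln0 big_geq.
have -> : 3 * m.+1 = (3 * m).+3 by lia.
rewrite !big_nat_recr //= IHm /digit; case: j {IHm} => [|j].
  rewrite expn0 !divn1; do 3 case: eqP => ?; lia.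
rewrite expnS !divnMA.
have -> : (3 * m).+1 %/ 3 = m by lia.
have -> : (3 * m).+2 %/ 3 = m by lia.
rewrite mulKn //; do 3 case: eqP => ?; lia.
Qed.

Lemma digit_inj e i i' :
  (forall j, j < e -> digit j i = digit j i') -> i %% 3 ^ e = i' %% 3 ^ e.
Proof.
elim: e => [|e IHe] eqd; first by rewrite !modn1.
have {IHe} := IHe (fun j h => eqd j (leqW h)).
have d3 k : (k %/ 3 ^ e %% 3) * 3 ^ e + k %% 3 ^ e = k %% 3 ^ e.+1.
  have k_eq : k = k %/ 3 ^ e %/ 3 * 3 ^ e.+1
                  + (k %/ 3 ^ e %% 3 * 3 ^ e + k %% 3 ^ e).
    rewrite {1}(divn_eq k (3 ^ e)) {1}(divn_eq (k %/ 3 ^ e) 3) expnS; lia.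
  rewrite [in RHS]k_eq modnMDl; apply/esym/modn_small.
  have lt3 : k %/ 3 ^ e %% 3 <= 2 by rewrite -ltnS ltn_pmod.
  have ltb : k %% 3 ^ e < 3 ^ e by rewrite ltn_pmod ?expn_gt0.
  rewrite expnS; move: (k %/ 3 ^ e %% 3) (k %% 3 ^ e) (3 ^ e) lt3 ltb => u v n; nia.
rewrite -!d3 => ->; congr (_ * _ + _).
have := eqd 0 isT; have := eqd e (leqnn _); rewrite /digit !expn0 !divn1; lia.
Qed.

Lemma column_lt3 a Q Q' i : column a Q Q' i < 3.
Proof. by rewrite /column; do 4 case: ifP => // _. Qed.

Lemma sum_classes (n : nat) (c y : nat -> nat) : (forall i, c i < 3) ->
  \sum_(0 <= i < n | c i == 0) y i + \sum_(0 <= i < n | c i == 1) y i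
  + \sum_(0 <= i < n | c i == 2) y i = \sum_(0 <= i < n) y i.
Proof.
move=> c3; rewrite 3!(big_mkcond (fun i => c i == _)) /= -!big_split /=.
by apply: eq_bigr => i _; have := c3 i; case: (c i) => [|[|[|]]] //=; lia.
Qed.

(** The last hypothesis says that the equations, once the numbers of selected
    copies of A and A' are eliminated through [b] = lam0 - #A and
    [b'] = lam0 - #A', leave only the trivial values of lam0: the total of the
    three classes is 3 lam0, so the selected words other than A and A' are
    lam0 + b + b' in number.
    The first [r] positions are the given ones and the last [e] are digits.  The
    digits separate words at distance less than 3 ^ e, which is enough within
    the copies of A, within those of A' and within the other words; the first
    [r] positions separate these three zones. *)
Lemma words_of_columns (lam k r e : nat) (Q Q' : nat -> seq nat) :
  k <= lam -> 0 < r -> lam + k.*2 <= 3 ^ e ->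
  (forall j, j < r -> [/\ uniq (Q j ++ Q' j), size (Q j) = k, size (Q' j) = k
     & {in Q j ++ Q' j, forall o, o < lam + k.*2}]) ->
  (forall o, (exists2 j, j < r & o \notin Q j) /\
             (exists2 j, j < r & o \notin Q' j)) ->
  (forall (y : nat -> nat) (b b' : nat), (forall o, y o <= 1) ->
     (forall j, j < r ->
        \sum_(o <- Q j) y o = b /\ \sum_(o <- Q' j) y o = b') ->
     \sum_(0 <= o < lam + k.*2) y o = b + b' \/
     \sum_(0 <= o < lam + k.*2) y o = b + b' + lam) ->
  exists w, indecomposable_words lam (r + e) w.
Proof.
move=> lekl r0 le3e Qok Qout force; set a := lam - k.
have E3 : 3 * lam = a + a + (lam + k.*2) by rewrite /a; lia.
pose w i p := if p < r then column a (Q p) (Q' p) i else digit (p - r) i.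
have colsum j (y : nat -> nat) : j < r ->
  \sum_(0 <= i < 3 * lam | w i j == 0) y i
    = \sum_(0 <= i < a) y i + \sum_(o <- Q j) y (o + (a + a)) /\
  \sum_(0 <= i < 3 * lam | w i j == 1) y i
    = \sum_(a <= i < a + a) y i + \sum_(o <- Q' j) y (o + (a + a)).
  move=> jr; rewrite /w jr E3; have [uQ _ _ ltQ] := Qok _ jr.
  move: uQ; rewrite cat_uniq => /and3P[uQ /hasPn dQ uQ'].
  apply: sum_column => // o oQ; first by apply: ltQ; rewrite mem_cat oQ.
    by apply: ltQ; rewrite mem_cat oQ orbT.
  by apply/negP => /dQ; rewrite /= oQ.
have w3 i p : w i p < 3 by rewrite /w; case: ifP; rewrite ?column_lt3 ?ltn_pmod.
exists w; split=> //.
- move=> p v pq v3; case: (ltnP p r) => pr; last first.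
    by rewrite /w ltnNge pr; exact: digit_balanced.
  have [_ sQ sQ' _] := Qok _ pr; have [] := colsum _ (fun=> 1) pr.
  have := @sum_classes (3 * lam) (w^~ p) (fun=> 1) (w3^~ p).
  rewrite !sum1_size !size_iota sQ sQ' => H0 H1 H2.
  have {H1} H1 : \sum_(0 <= i < 3 * lam | w i p == 0) 1 = lam by rewrite H1 /a; lia.
  have {H2} H2 : \sum_(0 <= i < 3 * lam | w i p == 1) 1 = lam by rewrite H2 /a; lia.
  by case: v v3 => [|[|[|v]]] // _; lia.
- move=> i i' li li' eqw.
  have wzone o : o < a -> exists2 j, j < r & w o j = 0.
    by move=> oa; exists 0 => //; rewrite /w r0 /column oa.
  have em : i %% 3 ^ e = i' %% 3 ^ e.
    apply: digit_inj => j je; have := eqw (r + j).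
    by rewrite ltn_add2l je /w ltnNge leq_addr /= addKn; apply.
  have close u v : u <= v < u + 3 ^ e -> u %% 3 ^ e = v %% 3 ^ e -> u = v.
    move=> /andP[uv vu] /esym/eqP; rewrite eqn_mod_dvd // => /dvdnP[[|c] E].
      by lia.
    by move: E; rewrite mulSn; lia.
  have {}close u v : u < v + 3 ^ e -> v < u + 3 ^ e ->
      u %% 3 ^ e = v %% 3 ^ e -> u = v.
    move=> h1 h2 h3; case: (leqP u v) => uv; first by apply: close; rewrite ?uv.
    by apply/esym/close; rewrite ?(ltnW uv).
  have c0 j u : j < r -> u < a -> w u j = 0 by move=> jr ua; rewrite /w jr /column ua.
  have c1 j u : j < r -> a <= u < a + a -> w u j = 1.
    by move=> jr /andP[ua ub]; rewrite /w jr /column ltnNge ua ub.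
  have out0 u : a + a <= u -> exists2 j, j < r & w u j != 0.
    move=> ua; have [[j jr oQ] _] := Qout (u - (a + a)); exists j => //.
    rewrite /w jr /column.
    have -> : (u < a) = false by lia.
    have -> : (u < a + a) = false by lia.
    by rewrite (negbTE oQ); case: ifP.
  have out1 u : a + a <= u -> exists2 j, j < r & w u j != 1.
    move=> ua; have [_ [j jr oQ]] := Qout (u - (a + a)); exists j => //.
    rewrite /w jr /column.
    have -> : (u < a) = false by lia.
    have -> : (u < a + a) = false by lia.
    by rewrite (negbTE oQ); case: ifP.
  (* Words with equal prefixes lie in a common zone, shorter than 3 ^ e. *)
  have zone u v : u < 3 * lam -> v < 3 * lam ->
      (forall p, p < r + e -> w u p = w v p) -> u <= v -> v < u + 3 ^ e.
    move=> lu lv E uv; have Er j : j < r -> w u j = w v j by move=> jr; apply: E; lia.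
    case: (ltnP u a) => ua.
      case: (ltnP v a) => va; first by rewrite /a in va *; lia.
      case: (ltnP v (a + a)) => vb.
        by have := Er _ r0; rewrite c0 // c1 // va.
      by have [j jr] := out0 _ vb; rewrite -Er // c0.
    case: (ltnP u (a + a)) => ub; last by lia.
    case: (ltnP v (a + a)) => vb; first by rewrite /a in ua ub vb *; lia.
    by have [j jr] := out1 _ vb; rewrite -Er // c1 // ua.
  case: (leqP i i') => ii'.
    have := zone _ _ li li' eqw ii' => ?; apply: close => //; lia.
  have := zone _ _ li' li (fun p h => esym (eqw p h)) (ltnW ii') => ?.
  by apply: close => //; lia.
- move=> y lam0 y1 bal.
  pose A := \sum_(0 <= i < a) y i; pose A' := \sum_(a <= i < a + a) y i.
  have balr j v : j < r -> v < 3 -> \sum_(0 <= i < 3 * lam | w i j == v) y i = lam0.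
    by move=> jr v3; apply: bal => //; lia.
  have sums j : j < r -> \sum_(o <- Q j) y (o + (a + a)) = lam0 - A /\
                         \sum_(o <- Q' j) y (o + (a + a)) = lam0 - A'.
    move=> jr; have [] := colsum _ y jr; rewrite !balr // /A /A'; lia.
  have leA : A <= lam0 /\ A' <= lam0.
    by have [] := colsum _ y r0; rewrite !balr // /A /A'; lia.
  have tot : A + A' + \sum_(0 <= o < lam + k.*2) y (o + (a + a)) = 3 * lam0.
    have := @sum_classes (3 * lam) (w^~ 0) y (w3^~ 0).
    rewrite !balr // E3 (big_cat_nat (n := a + a)) //=; last by lia.
    rewrite (big_cat_nat (n := a)) //=; last by lia.
    have := @big_addn _ 0 addn 0 (a + a + (lam + k.*2)) (a + a) predT y.
    rewrite add0n; have -> : a + a + (lam + k.*2) - (a + a) = lam + k.*2 by lia.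
    by move=> ->; rewrite -/A -/A' /=; lia.
  have := force (fun o => y (o + (a + a))) _ _ (fun o => y1 _) sums.
  by move: leA tot => [? ?]; lia.
Qed.

(** Here k = 1 and the other words have multiplicity 1: position j forces the
    word j to be selected as often as the word 0, and j + 1 as often as 1.  With
    k = 5 the multiplicity lam - k would be negative. *)
Lemma words_small lam q : 2 <= lam < 5 -> 8 <= q ->
  exists w, indecomposable_words lam q w.
Proof.
move=> /andP[l2 l5] q8; have -> : q = lam.+1 + (q - lam.+1) by lia.
apply: (@words_of_columns _ 1 _ _ (fun j => [:: j]) (fun j => [:: j.+1])) => //.
- lia.
- have : 3 ^ 3 <= 3 ^ (q - lam.+1) by rewrite leq_exp2l //; lia.
  by rewrite (_ : 3 ^ 3 = 27) //; lia.
- move=> j jl; split=> //= [|o]; first by rewrite inE; lia.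
  by rewrite !inE => /orP[] /eqP->; lia.
- move=> o; split.
    by case: o => [|o]; [exists 1 | exists 0]; rewrite ?inE //; lia.
  by case: o => [|[|o]]; [exists 0 | exists 1 | exists 0]; rewrite ?inE //; lia.
- move=> y b b' y1 H.
  have {}H j : j < lam.+1 -> y j = b /\ y j.+1 = b'.
    by move=> /H; rewrite !big_seq1.
  have bb' : b = b' by have [h _] := H 1 (leqW l2); have [_ ] := H 0 isT; rewrite h.
  have yb o : o < lam.+2 -> y o = b.
    by case: o => [_|o /H[_ ->]]; [case: (H 0 isT) | rewrite bb'].
  have -> : \sum_(0 <= o < lam + 1.*2) y o = lam.+2 * b.
    rewrite (@eq_big_nat _ _ _ _ _ _ (fun=> b)).
      by rewrite sum_nat_const_nat; congr (_ * _); lia.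
    by move=> o ol; apply: yb; lia.
  by have := y1 0; rewrite yb // -bb'; case: b {H bb' yb} => [|[|]] //; lia.
Qed.

Lemma sum_blocks (y : nat -> nat) s0 k n :
  \sum_(s0 <= o < s0 + k * n) y o
    = \sum_(0 <= m < n) \sum_(o <- iota (s0 + k * m) k) y o.
Proof.
elim: n => [|n IHn]; first by rewrite muln0 addn0 !big_geq.
rewrite big_nat_recr //= -IHn (big_cat_nat (n := s0 + k * n)) //=; try lia.
by congr (_ + bigop _ _ _); congr iota; lia.
Qed.

(** The words other than A and A' are numbered as follows, for k = 5.  The words
    0 | 1 | 2 3 | 4 5 | 6 7 8 are five distinct words with their copies; then
    come blocks of five copies of one word; the last block may be shorter. *)
Definition block (m : nat) : seq nat := iota (9 + 5 * m) 5.

(** A union of the first five words, of total multiplicity [n] and disjoint from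
    2, 3, 6, 7, 8; it completes a short last block to a set of total 5. *)
Definition complement5 (n : nat) : seq nat :=
  nth [::] [:: [::]; [:: 0]; [:: 0; 1]; [:: 0; 4; 5]; [:: 0; 1; 4; 5]] n.

Definition last_block (lam : nat) : seq nat :=
  complement5 (4 - lam %% 5) ++ iota (9 + 5 * (lam %/ 5)) (lam %% 5).+1.

(** Positions beyond the available blocks use the block 0 again. *)
Definition block_of (lam m : nat) : seq nat :=
  block (if m < lam %/ 5 then m else 0).

(** The sets Q and Q' of each position.  The positions 0 to 4 contain the five
    sets that determine the first five words; as the block 0 occurs both as a Q
    and as a Q', the common values of both kinds of sets agree. *)
Definition first_set (lam j : nat) : seq nat :=
  match j with
  | 0 => [:: 2; 3; 6; 7; 8]
  | 1 => [:: 4; 5; 6; 7; 8]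
  | 2 => [:: 0; 1; 6; 7; 8]
  | 3 => [:: 0; 2; 3; 4; 5]
  | 4 => block_of lam 0
  | j'.+2 => block_of lam j'
  end.

Definition second_set (lam j : nat) : seq nat :=
  match j with
  | 0 => last_block lam
  | 1 => block_of lam 0
  | 2 => block_of lam 1
  | 3 => block_of lam 2
  | 4 => [:: 1; 2; 3; 4; 5]
  | _ => [:: 2; 3; 6; 7; 8]
  end.

(** This makes room for the digits when the number of positions is large. *)
Lemma pow3_ge e : 4 <= e -> 10 * e + 70 <= 3 ^ e.+1.
Proof.
elim: e => // e IHe; rewrite leq_eqVlt => /orP[/eqP<- //|/IHe].
rewrite (expnS 3 e.+1); lia.
Qed.

Lemma mem_block_of lam m o : 5 <= lam -> o \in block_of lam m ->
  9 <= o < 9 + 5 * (lam %/ 5).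
Proof. by move=> l5; rewrite /block_of mem_iota; case: ifP => h; lia. Qed.

(** The sums over the five sets of total 5 determine the selection of the first
    five words from that of the word 0. *)
Lemma base_solution (y : nat -> nat) b :
  y 2 + (y 3 + (y 6 + (y 7 + (y 8 + 0)))) = b ->
  y 4 + (y 5 + (y 6 + (y 7 + (y 8 + 0)))) = b ->
  y 0 + (y 1 + (y 6 + (y 7 + (y 8 + 0)))) = b ->
  y 0 + (y 2 + (y 3 + (y 4 + (y 5 + 0)))) = b ->
  y 1 + (y 2 + (y 3 + (y 4 + (y 5 + 0)))) = b ->
  [/\ y 1 = y 0, y 2 + y 3 = 2 * y 0, y 4 + y 5 = 2 * y 0,
      y 6 + y 7 + y 8 = 3 * y 0 & b = 5 * y 0].
Proof. by move=> *; split; lia. Qed.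

Lemma words_large lam q : 5 <= lam -> lam <= 2 * q + 1 -> 8 <= q ->
  exists w, indecomposable_words lam q w.
Proof.
move=> l5 lq q8.
(* The blocks 0, 1, 2 occur at the positions 1, 2, 3, and the block m >= 3 at m + 2. *)
pose r := maxn 5 (lam %/ 5 + 2).
have rq : r <= q by rewrite /r; lia.
rewrite -(subnKC rq).
have t1 : 0 < lam %/ 5 by lia.
have rho5 : lam %% 5 < 5 by rewrite ltn_pmod.
have lamE := divn_eq lam 5.
have [r5 rt] : 5 <= r /\ lam %/ 5 + 2 <= r by rewrite /r; lia.
apply: (@words_of_columns _ 5 _ _ (first_set lam) (second_set lam)) => //.
- lia.
- (* The case lam = 17, q = 8 is tight: 27 words besides A and A', 3 digits. *)
  case: (leqP lam 17) => l17.
    have : 3 ^ 3 <= 3 ^ (q - r) by rewrite leq_exp2l // /r; lia.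
    by rewrite (_ : 3 ^ 3 = 27) //; lia.
  case: (leqP q 11) => q11.
    have : 3 ^ 4 <= 3 ^ (q - r) by rewrite leq_exp2l // /r; lia.
    by rewrite (_ : 3 ^ 4 = 81) //; lia.
  have [e eE] : exists e, q - r = e.+1 by exists (q - r).-1; rewrite /r; lia.
  have := @pow3_ge e; rewrite eE; move: eE; rewrite /r; lia.
- have block_ok m (P : seq nat) : uniq P -> size P = 5 -> all (gtn 9) P ->
      [/\ uniq (P ++ block_of lam m), size P = 5, size (block_of lam m) = 5 &
          {in P ++ block_of lam m, forall o, o < lam + 5.*2}].
    move=> uP sP /allP P9; split=> //.
    + rewrite cat_uniq uP iota_uniq andbT; apply/hasPn => o /(mem_block_of l5) h.
      by apply/negP => /P9 /=; lia.
    by move=> o; rewrite mem_cat => /orP[/P9 /= | /(mem_block_of l5)]; lia.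
  have block_ok' m (P : seq nat) : uniq P -> size P = 5 -> all (gtn 9) P ->
      [/\ uniq (block_of lam m ++ P), size (block_of lam m) = 5, size P = 5 &
          {in block_of lam m ++ P, forall o, o < lam + 5.*2}].
    move=> uP sP /(block_ok m _ uP sP)[h1 h2 h3 h4]; rewrite uniq_catC; split=> // o.
    by rewrite mem_cat orbC -mem_cat; apply: h4.
  case=> [|[|[|[|[|j]]]]] _; try exact: block_ok; try exact: block_ok'.
  split=> //; rewrite /second_set /last_block.
  + move: (lam %% 5) rho5 => rho rho5; rewrite catA cat_uniq iota_uniq andbT;
    apply/andP; split.
      by case: rho rho5 => [|[|[|[|[|]]]]].
    apply/hasPn => o; rewrite mem_iota => h; apply/negP => /= h'.
    suff: o < 9 by lia.
    move: h'; case: rho rho5 {h} => [|[|[|[|[|]]]]] //= _; rewrite !inE;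
    by do ?[case/orP]; move/eqP->.
  + rewrite size_cat size_iota.
    by case: (lam %% 5) rho5 => [|[|[|[|[|]]]]].
  + move=> o; rewrite catA mem_cat.
    case/orP=> [h'|]; last by rewrite mem_iota; lia.
    suff: o < 9 by lia.
    move: h'; case: (lam %% 5) rho5 => [|[|[|[|[|]]]]] //= _; rewrite !inE;
    by do ?[case/orP]; move/eqP->.
- move=> o; split.
    case: (leqP 9 o) => o9; first by exists 0; rewrite /= ?inE; lia.
    case: (ltnP 5 o) => o5; first by exists 3; rewrite /= ?inE; lia.
    case: (ltnP 3 o) => o3; first by exists 0; rewrite /= ?inE; lia.
    by exists 1; rewrite /= ?inE; lia.
  case: (leqP 9 o) => o9; first by exists 4; rewrite /= ?inE; lia.
  exists 1; rewrite /=; first lia.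
  by apply/negP => /(mem_block_of l5); lia.
- move=> y b b' y1 H.
  have [H00 H01] := H 0 (leq_trans (isT : 0 < 5) r5).
  have [H10 H11] := H 1 (leq_trans (isT : 1 < 5) r5).
  have [H20 H21] := H 2 (leq_trans (isT : 2 < 5) r5).
  have [H30 H31] := H 3 (leq_trans (isT : 3 < 5) r5).
  have [H40 H41] := H 4 r5.
  rewrite /= in H11 H40; have bb' : b = b' by rewrite -H11 -H40.
  rewrite -{}bb' in H01 H11 H21 H31 H41 *.
  have blocks m : m < lam %/ 5 -> \sum_(o <- block m) y o = b.
    case: m => [|[|[|m]]] mt.
    - by move: H11; rewrite /block_of mt.
    - by move: H21; rewrite /= /block_of mt.
    - by move: H31; rewrite /= /block_of mt.
    - have [+ _] := H m.+1.+4 ltac:(lia).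
      by rewrite /= /block_of mt.
  have -> : \sum_(0 <= o < lam + 5.*2) y o = \sum_(0 <= o < 9) y o
     + (lam %/ 5) * b + \sum_(o <- iota (9 + 5 * (lam %/ 5)) (lam %% 5).+1) y o.
    have cat u v n : u <= v <= n -> \sum_(u <= o < n) y o
        = \sum_(u <= o < v) y o + \sum_(v <= o < n) y o.
      by move=> /andP[uv vn]; exact: big_cat_nat.
    have -> := cat 0 9 (lam + 5.*2) ltac:(lia).
    have -> := cat 9 (9 + 5 * (lam %/ 5)) (lam + 5.*2) ltac:(lia).
    have -> : \sum_(9 <= o < 9 + 5 * (lam %/ 5)) y o = lam %/ 5 * b.
      rewrite sum_blocks (@eq_big_nat _ _ _ _ _ _ (fun=> b)).
        by rewrite sum_nat_const_nat subn0.
      by move=> m /andP[_]; exact: blocks.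
    by rewrite addnA; congr (_ + bigop _ _ _); congr iota; lia.
  move: H01; rewrite /second_set /last_block big_cat.
  set L := \sum_(o <- iota (9 + _) _) _ => H01.
  have -> : \sum_(0 <= o < 9) y o = y 0 + y 1 + y 2 + y 3 + y 4 + y 5 + y 6 + y 7 + y 8.
    by rewrite !big_nat_recr //= big_geq.
  move: H00 H10 H20 H30 H41; rewrite /= !big_cons !big_nil => H00 H10 H20 H30 H41.
  have [y1E y23E y45E y678E bE] := base_solution H00 H10 H20 H30 H41.
  have comp : \sum_(o <- complement5 (4 - lam %% 5)) y o = (4 - lam %% 5) * y 0.
    move: rho5; clear -y1E y45E; case: (lam %% 5) => [|[|[|[|[|]]]]] //= _;
    rewrite !(big_cons, big_nil); lia.
  have {H01}H01 : L = (lam %% 5).+1 * y 0.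
    move: H01; rewrite {}comp bE /=; move: (lam %% 5) rho5; clear.
    by case=> [|[|[|[|[|]]]]] // _; lia.
  rewrite {}H01 {}bE; have := y1 0; move: y1E y23E y45E y678E lamE; clear.
  move: (lam %/ 5) (lam %% 5) => t rho y1E y23E y45E y678E lamE.
  by case: (y 0) y1E y23E y45E y678E => [|[|]] //; lia.
Qed.

Lemma exists_words lam q : 2 <= lam <= 2 * q + 1 -> 8 <= q ->
  exists w, indecomposable_words lam q w.
Proof.
move=> /andP[l2 lq] q8; case: (ltnP lam 5) => l5.
  by apply: words_small => //; rewrite l2.
exact: words_large.
Qed.

(** * From involutions to multisets of 1-factors *)

Section FactorOfInvolution.
Variable T : finType.

Definition factor (h : T -> T) : {set {set T}} := [set [set x; h x] | x : T].

Variable h : T -> T.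
Hypotheses (hK : involutive h) (h_neq : forall x, h x != x).

Lemma pair_in_factor x y : x != y -> ([set x; y] \in factor h) = (h x == y).
Proof.
move=> xy; apply/imsetP/eqP => [[z _ E] | <-]; last by exists x.
have : x \in [set z; h z] by rewrite -E set21.
have : y \in [set z; h z] by rewrite -E set22.
rewrite !inE => /orP[]/eqP yE /orP[]/eqP xE; move: xy; by rewrite xE yE ?eqxx ?hK.
Qed.

Lemma one_factor_factor : one_factor (factor h).
Proof.
apply/andP; split.
  by apply/forall_inP => e /imsetP[x _ ->]; rewrite cards2 (eq_sym x) h_neq.
apply/and3P; split.
- rewrite eqEsubset subsetT; apply/subsetP => x _.
  by apply/bigcupP; exists [set x; h x]; rewrite ?set21 //; apply/imsetP; exists x.
- apply/trivIsetP => A B /imsetP[x _ ->] /imsetP[y _ ->]; apply: contraR.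
  case/pred0Pn => z /andP[]; rewrite !inE.
  move=> /orP[]/eqP-> /orP[]/eqP E; apply/eqP.
  + by rewrite E.
  + by rewrite E hK setUC.
  + by rewrite -E hK setUC.
  + by rewrite (inv_inj hK E).
- by apply/negP => /imsetP[x _ /setP/(_ x)]; rewrite !inE eqxx.
Qed.

End FactorOfInvolution.

(** Since distinct indices give distinct factors, a submultiset is a subset [J]
    of the indices, which is what the last hypothesis controls. *)
Lemma factorization_of_involutions (T I : finType) (lam : nat) (h : I -> T -> T) :
  (forall a, involutive (h a)) -> (forall a x, h a x != x) ->
  (forall a b, h a =1 h b -> a = b) ->
  (forall x y, x != y -> #|[set a | h a x == y]| = lam) ->
  (forall (J : {set I}) (lam0 : nat),
     (forall x y, x != y -> #|[set a in J | h a x == y]| = lam0) ->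
     lam0 = 0 \/ lam0 = lam) ->
  exists M : {mset {set {set T}}},
    [/\ one_factorization lam M, simple_factorization M & indecomposable lam M].
Proof.
move=> hK h_neq h_inj cover indec.
pose F a := factor (h a).
have F_inj : injective F.
  move=> a b eqF; apply: h_inj => x; apply/esym/eqP.
  by rewrite -pair_in_factor 1?eq_sym // -[factor _]/(F b) -eqF pair_in_factor // eq_sym.
pose M : {mset {set {set T}}} := seq_mset (codom F).
have ME E : M E = (E \in codom F).
  by rewrite mset_seqE count_uniq_mem // map_inj_uniq // enum_uniq.
have count_sub (N : {mset {set {set T}}}) x y : (forall E, N E <= M E) -> x != y ->
    \sum_(E : {set {set T}} | [set x; y] \in E) N E
      = #|[set a in [set a | F a \in N] | h a x == y]|.
  move=> leNM xy; rewrite (bigID (mem (F @: I))) /= [X in _ + X]big1 ?addn0; last first.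
    move=> E /andP[_ nE]; apply/eqP; rewrite -leqn0 (leq_trans (leNM E)) // ME.
    by rewrite leqn0 eqb0; apply: contra nE => /codomP[a ->]; rewrite imset_f.
  rewrite (eq_bigl (fun E => (E \in F @: I) && ([set x; y] \in E))); last first.
    by move=> E; rewrite andbC.
  rewrite big_mkcondr /= big_imset /=; last by move=> a b _ _; apply: F_inj.
  rewrite -sum1dep_card big_mkcond /= [RHS]big_mkcond /=; apply: eq_bigr => a _.
  rewrite pair_in_factor // inE -mset_gt0.
  have := leNM (F a); rewrite ME codom_f; case: (h a x == y); rewrite ?andbF //.
  by case: (N (F a)) => [|[|]].
exists M; split.
- split=> [E | x y xy].
    by rewrite -mset_gt0 ME lt0b => /codomP[a ->]; exact: one_factor_factor.
  rewrite count_sub // -(cover x y xy); apply: eq_card => a.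
  by rewrite !inE -mset_gt0 ME codom_f.
- by move=> E; rewrite ME leq_b1.
- case=> lam0 [/andP[l1 l2] [M1 [M2 [[_ fact1] _ MD]]]].
  have leM E : M1 E <= M E by rewrite MD msetE2 leq_addr.
  case: (indec [set a | F a \in M1] lam0) => [x y xy | |]; [|lia|lia].
  by rewrite -count_sub // fact1.
Qed.

Definition vertex (s : nat) (x : nat * bool) : bool := x.1 < s.

Definition matching (s : nat) (f : nat * bool -> nat * bool) : Prop :=
  forall x, vertex s x -> [/\ vertex s (f x), f (f x) = x & f x != x].

(** The vertex (i, y) of the abstract description is the integer 2 i + y. *)
Lemma factorization_of_matchings (s lam : nat) (I : finType)
    (f : I -> nat * bool -> nat * bool) :
  (forall a, matching s (f a)) ->
  (forall a b, (forall x, vertex s x -> f a x = f b x) -> a = b) ->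
  (forall x y, vertex s x -> vertex s y -> x != y ->
     #|[set a | f a x == y]| = lam) ->
  (forall (J : {set I}) (lam0 : nat),
     (forall x y, vertex s x -> vertex s y -> x != y ->
        #|[set a in J | f a x == y]| = lam0) ->
     lam0 = 0 \/ lam0 = lam) ->
  exists M : {mset {set {set 'I_(2 * s)}}},
    [/\ one_factorization lam M, simple_factorization M & indecomposable lam M].
Proof.
move=> fP f_inj cover indec.
pose dec (v : 'I_(2 * s)) : nat * bool := ((v : nat)./2, odd v).
have decP v : vertex s (dec v) by rewrite /vertex /=; have := ltn_ord v; lia.
have enc_lt x : vertex s x -> x.1.*2 + x.2 < 2 * s.
  by rewrite /vertex; case: x.2 => /=; lia.
pose enc (v0 : 'I_(2 * s)) (x : nat * bool) : 'I_(2 * s) := insubd v0 (x.1.*2 + x.2).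
have encK v0 x : vertex s x -> dec (enc v0 x) = x.
  move=> /enc_lt lt2; case: x lt2 => i b lt2; rewrite /dec val_insubd lt2 /=.
  by congr (_, _); rewrite ?oddD ?odd_double; case: b {lt2} => /=; lia.
have dec_inj : injective dec.
  move=> u v [h1 h2]; apply: val_inj => /=.
  by rewrite -[LHS]odd_double_half -[RHS]odd_double_half h1 h2.
pose h a v := enc v (f a (dec v)).
have dech a v : dec (h a v) = f a (dec v) by apply: encK; case: (fP a _ (decP v)).
have hE a u v : (h a u == v) = (f a (dec u) == dec v).
  by rewrite -dech; apply/eqP/eqP => [-> | /dec_inj].
apply: (@factorization_of_involutions _ I lam h).
- by move=> a v; apply: dec_inj; rewrite !dech; case: (fP a _ (decP v)).
- by move=> a v; rewrite hE; case: (fP a _ (decP v)).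
- move=> a b eqh; apply: f_inj => -[i y] xs.
  have v0 : 'I_(2 * s) by exists 0; move: xs; rewrite /vertex /=; lia.
  by rewrite -(encK v0 (i, y) xs) -!dech eqh.
- move=> u v uv; rewrite -(cover (dec u) (dec v)) ?inj_eq //.
  by apply: eq_card => a; rewrite !inE hE.
- move=> J lam0 Jcover; apply: (indec J) => x y xs ys xy.
  have v0 : 'I_(2 * s) by exists 0; move: xs; rewrite /vertex /=; lia.
  rewrite -(Jcover (enc v0 x) (enc v0 y)); last first.
    by rewrite -(inj_eq dec_inj) !encK.
  by apply: eq_card => a; rewrite !inE hE !encK.
Qed.

(** * Reassembling three factors along their components *)

Lemma card_sum_type (X Y : finType) (P : pred (X + Y)) :
  #|[set c | P c]| = #|[set x | P (inl x)]| + #|[set y | P (inr y)]|.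
Proof. by rewrite -!sum1dep_card big_sumType. Qed.

(** [comp] is constant on the components of the union of the three factors
    [g 0], [g 1], [g 2]; the [f a] are lam copies of the other factors.  In a
    balanced subfamily the edges of [g v] on the component p count the words
    with letter v at p, hence the indecomposability. *)
Lemma factorization_of_words (s q lam : nat) (w : nat -> nat -> nat)
    (comp : nat -> nat) (g : nat -> nat * bool -> nat * bool)
    (I : finType) (f : I -> nat * bool -> nat * bool) :
  indecomposable_words lam q w -> 0 < q ->
  (forall x, vertex s x -> comp x.1 < q) ->
  (forall p, p < q -> exists2 x, vertex s x & comp x.1 = p) ->
  (forall v, v < 3 -> matching s (g v)) ->
  (forall v x, v < 3 -> vertex s x -> comp (g v x).1 = comp x.1) ->
  (forall v v' x, v < 3 -> v' < 3 -> vertex s x -> g v x = g v' x -> v = v') ->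
  (forall a, matching s (f a)) ->
  (forall a b, (forall x, vertex s x -> f a x = f b x) -> a = b) ->
  (forall x y, vertex s x -> vertex s y -> x != y ->
     #|[set a | f a x == y]|
       = if [|| g 0 x == y, g 1 x == y | g 2 x == y] then 0 else lam) ->
  exists M : {mset {set {set 'I_(2 * s)}}},
    [/\ one_factorization lam M, simple_factorization M & indecomposable lam M].
Proof.
case=> [w3 wbal winj windec] q0 compq compP gP gcomp gneq fP f_inj fcover.
pose F (c : 'I_(3 * lam) + I) x :=
  match c with inl i => g (w i (comp x.1)) x | inr a => f a x end.
have gF x y v i : vertex s x -> v < 3 -> g v x = y ->
    (F (inl i) x == y) = (w i (comp x.1) == v).
  move=> xs v3 <-; apply/eqP/eqP => /= [|-> //].
  by move/gneq; apply.
have f0 x v : vertex s x -> v < 3 -> #|[set a | f a x == g v x]| = 0.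
  move=> xs v3; have [gs _ gx] := gP v v3 x xs; rewrite fcover 1?eq_sym //.
  by case: v v3 {gs gx} => [|[|[|]]] // _; rewrite eqxx ?orbT.
have count_rows (y : nat -> nat) p v :
    \sum_(0 <= i < 3 * lam | w i p == v) y i = \sum_(i < 3 * lam | w i p == v) y i.
  by rewrite big_mkord.
apply: (@factorization_of_matchings s lam _ F).
- move=> [i|a] x xs; last exact: fP.
  have [gs gK gx] := gP _ (w3 i (comp x.1)) x xs; split=> //=.
  by rewrite gcomp.
- have inl_inr i a : ~ (forall x, vertex s x -> F (inl i) x = F (inr a) x).
    move=> E; have [x xs _] := compP 0 q0.
    have /eqP := f0 x _ xs (w3 i (comp x.1)); rewrite cards_eq0 => /eqP/setP/(_ a).
    by rewrite !inE -[f a x]/(F (inr a) x) -E // eqxx.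
  move=> [i|a] [j|b] E.
  + congr inl; apply: val_inj; apply: winj; try exact: ltn_ord.
    by move=> p /compP[x xs <-]; apply: gneq (E x xs).
  + by case: (inl_inr i b).
  + by case: (inl_inr j a) => x xs; rewrite E.
  + by congr inr; apply: f_inj => x /E.
- move=> x y xs ys xy; rewrite card_sum_type /= fcover //.
  case: ifP => [gxy | /norP/=].
    have [v v3 gv] : exists2 v, v < 3 & g v x = y.
      by case/or3P: gxy => /eqP; [exists 0 | exists 1 | exists 2].
    rewrite addn0; apply: etrans (wbal (comp x.1) v (compq x xs) v3).
    rewrite count_rows sum1dep_card.
    by apply: eq_card => i; rewrite !inE (gF _ _ v).
  case=> g0 /norP[g1 g2]; rewrite -[RHS]add0n; congr (_ + _).
  apply/eqP; rewrite cards_eq0; apply/eqP/setP => i; rewrite !inE /=.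
  have := w3 i (comp x.1); case: (w i _) => [|[|[|]]] // _;
  by apply/negbTE.
- move=> J lam0 Jcover.
  pose y i : nat := if insub i is Some o then (inl o \in J : nat) else 0.
  apply: (windec y) => [i | p v pq v3].
    by rewrite /y; case: insubP => // o _ _; rewrite leq_b1.
  have [x xs xp] := compP p pq; have [gs _ gx] := gP v v3 x xs.
  rewrite -(Jcover x (g v x)) 1?eq_sym // card_sum_type.
  have -> : #|[set a | (inr a \in J) && (F (inr a) x == g v x)]| = 0.
    apply/eqP; rewrite cards_eq0 -subset0; have /eqP := f0 x v xs v3.
    rewrite cards_eq0 => /eqP <-; apply/subsetP => a.
    by rewrite !inE => /andP[].
  rewrite addn0 count_rows -sum1dep_card big_mkcondr /= big_mkcond /= [RHS]big_mkcond.
  apply: eq_bigr => i _; rewrite /y valK (gF x _ v) // xp.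
  by do 2 case: ifP.
Qed.

(** * The factors with a given difference *)

Definition bit (k i : nat) : bool := odd (k %/ 2 ^ i).

Lemma bit_inj n k k' : k < 2 ^ n -> k' < 2 ^ n ->
  (forall i, i < n -> bit k i = bit k' i) -> k = k'.
Proof.
elim: n k k' => [|n IHn] k k'; first by rewrite !expn0; lia.
rewrite !expnS => lk lk' eqb.
have b0 := eqb 0 isT; rewrite /bit !expn0 !divn1 in b0.
have : k./2 = k'./2.
  apply: IHn => [||i ilt]; [lia | lia |].
  by have := eqb i.+1 ilt; rewrite /bit expnS !divnMA !divn2.
by move: b0; lia.
Qed.

Lemma bit_high n k i : k < 2 ^ n -> n <= i -> bit k i = false.
Proof.
move=> lk ni; rewrite /bit divn_small //.
by apply: leq_trans lk _; rewrite leq_exp2l.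
Qed.

Lemma card_set_sum (A : finType) (P : pred A) : #|[set a | P a]| = \sum_a P a.
Proof. by rewrite -sum1dep_card big_mkcond; apply: eq_bigr => a _; case: (P a). Qed.

Lemma card_pairs1 (A B : finType) (P : A -> B -> bool) :
  #|[set p : A * B | P p.1 p.2]| = \sum_a #|[set b | P a b]|.
Proof.
rewrite card_set_sum -(pair_bigA _ (fun a b => nat_of_bool (P a b))) /=.
by apply: eq_bigr => a _; rewrite card_set_sum.
Qed.

Lemma card_pairs2 (A B : finType) (P : A -> B -> bool) :
  #|[set p : A * B | P p.1 p.2]| = \sum_b #|[set a | P a b]|.
Proof.
rewrite card_set_sum -(pair_bigA _ (fun a b => nat_of_bool (P a b))) exchange_big.
by apply: eq_bigr => b _; rewrite card_set_sum.
Qed.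

Section Shift.
Variable s : nat.

Definition up (d i : nat) : nat := if i + d < s then i + d else i + d - s.
Definition down (d i : nat) : nat := if d <= i then i - d else i + s - d.
Definition dist (i j : nat) : nat := minn (i - j + (j - i)) (s - (i - j + (j - i))).

Lemma up_down d i : d <= s -> i < s -> up d (down d i) = i.
Proof. by rewrite /up /down; do 2 case: ifP; lia. Qed.

Lemma down_up d i : d <= s -> i < s -> down d (up d i) = i.
Proof. by rewrite /up /down; do 2 case: ifP; lia. Qed.

Lemma up_lt d i : d <= s -> i < s -> up d i < s.
Proof. by rewrite /up; case: ifP; lia. Qed.

Lemma down_lt d i : 0 < d -> d <= s -> i < s -> down d i < s.
Proof. by rewrite /down; case: ifP; lia. Qed.

Lemma dist_eq d i j : 0 < d -> d.*2 < s -> i < s -> j < s ->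
  (dist i j == d) = (j == up d i) || (j == down d i).
Proof. by rewrite /dist /up /down; do 2 case: ifP; lia. Qed.

Lemma up_neq_down d i : 0 < d -> d.*2 < s -> i < s -> up d i != down d i.
Proof. by rewrite /up /down; do 2 case: ifP; lia. Qed.

(** A proper 3-colouring of the cycles i, i + d, i + 2d, ... of Z_s: the blocks of
    length d alternate between 0 and 1, and the last d elements, which lead back
    to the block of colour 0, have colour 2.  Odd cycles are thus allowed. *)
Definition shift_color (d i : nat) : nat :=
  if s - d <= i then 2 else odd (i %/ d).

Lemma shift_color_proper d i : 0 < d -> d.*2 <= s -> i < s ->
  shift_color d i != shift_color d (up d i).
Proof.
move=> d0 ds si; rewrite /shift_color /up.
case: (ltnP (i + d) s) => h.
  have -> : (s - d <= i) = false by lia.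
  case: ifP => _; first by case: odd.
  by rewrite divnDr // divnn d0 oddD; case: odd.
have -> : s - d <= i by lia.
have -> : (s - d <= i + d - s) = false by lia.
by rewrite divn_small //; lia.
Qed.

(** The three nonzero linear forms on F_2^2.  Any two are independent. *)
Definition functional (m : nat) (c : bool * bool) : bool :=
  match m with 0 => c.1 | 1 => c.2 | _ => c.1 (+) c.2 end.

Lemma functional_bij m m' (b b' : bool) : m < 3 -> m' < 3 -> m != m' ->
  #|[set c | (functional m c == b) && (functional m' c == b')]| = 1.
Proof.
have enum_bb (P : pred (bool * bool)) : #|[set c | P c]| =
    P (true, true) + P (true, false) + P (false, true) + P (false, false).
  rewrite card_set_sum (eq_bigr (fun c => nat_of_bool (P (c.1, c.2)))).
    rewrite -(pair_bigA _ (fun u v => nat_of_bool (P (u, v)))) !big_bool /=; lia.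
  by case.
by case: m m' => [|[|[|]]] // [|[|[|]]] // _ _ _; case: b; case: b';
  rewrite enum_bb.
Qed.

Lemma shift_color_lt3 d i : shift_color d i < 3.
Proof. by rewrite /shift_color; case: ifP => // _; case: odd. Qed.

(** The label of i is the layer from which i is joined to i + d, the other layer
    being joined to i - d.  As i and i + d have distinct colours, when [c] runs
    over F_2^2 the labels of i and i + d take each pair of values once, so that
    the four factors partition the edges of difference d.  Adding the binary
    digits of [k] exchanges layers and provides the copies. *)
Definition label (d : nat) (c : bool * bool) (k i : nat) : bool :=
  functional (shift_color d i) c (+) bit k i.

Definition shift_factor (d : nat) (c : bool * bool) (k : nat)
    (x : nat * bool) : nat * bool :=
  if x.2 == label d c k x.1 then (up d x.1, ~~ label d c k (up d x.1))
  else (down d x.1, label d c k (down d x.1)).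

Lemma shift_factor_matching d c k : 0 < d -> d.*2 < s ->
  matching s (shift_factor d c k).
Proof.
move=> d0 ds [i y]; rewrite /vertex /= => si; rewrite /shift_factor /=.
have ds' : d <= s by lia.
case: eqP => [->|/eqP ny] /=.
  split; first exact: up_lt.
  - rewrite down_up // ifN //; by case: (label d c k (up d i)).
  - by rewrite xpair_eqE negb_and; apply/orP; left; rewrite /up; case: ifP; lia.
split; first exact: down_lt.
- rewrite eqxx up_down //; congr (_, _).
  by move: ny; case: y; case: label.
- by rewrite xpair_eqE negb_and; apply/orP; left; rewrite /down; case: ifP; lia.
Qed.

Lemma card_shift_factor lam d i y j z : 0 < d -> d.*2 < s -> i < s -> j < s ->
  #|[set ck : (bool * bool) * 'I_lam | shift_factor d ck.1 ck.2 (i, y) == (j, z)]|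
  = if dist i j == d then lam else 0.
Proof.
move=> d0 ds si sj; rewrite dist_eq //.
have ds' : d <= s by lia.
have two i' (b b' : bool) : i' < s ->
    #|[set ck : (bool * bool) * 'I_lam |
        (label d ck.1 ck.2 i' == b) && (label d ck.1 ck.2 (up d i') == b')]| = lam.
  move=> si'; rewrite (card_pairs2 (fun c (k : 'I_lam) =>
    (label d c k i' == b) && (label d c k (up d i') == b'))).
  rewrite -[RHS]card_ord -sum1_card; apply: eq_bigr => k _.
  rewrite -[RHS](@functional_bij (shift_color d i') (shift_color d (up d i'))
    (b (+) bit k i') (b' (+) bit k (up d i'))); last 1 first.
  - by apply: shift_color_proper => //; lia.
  - by apply: eq_card => c; rewrite !inE /label; do 2 (case: functional);
      case: (bit k i'); case: (bit k (up d i')); case: b; case: b'.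
  - exact: shift_color_lt3.
  - exact: shift_color_lt3.
have [jup | jup] := eqVneq j (up d i) => /=.
  apply: etrans (two i y (~~ z) si); apply: eq_card => ck; rewrite !inE /shift_factor /=.
  rewrite jup [label d _ _ i == y]eq_sym; case: ifP => _ /=.
    by rewrite xpair_eqE eqxx /=; case: label; case: z.
  by rewrite xpair_eqE eq_sym (negbTE (up_neq_down _ _ _)).
have [jdn | jdn] := eqVneq j (down d i) => /=.
  apply: etrans (two j z (~~ y) sj); apply: eq_card => ck; rewrite !inE /shift_factor /=.
  rewrite jdn up_down //; case: ifP => [/eqP-> | /eqP/eqP ny] /=.
    rewrite xpair_eqE (negbTE (up_neq_down _ _ _)) //=.
    by case: (label d ck.1 ck.2 i); rewrite andbF.
  by rewrite xpair_eqE eqxx /=; move: ny; case: y; case: label; rewrite ?andbT.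
apply/eqP; rewrite cards_eq0 -subset0; apply/subsetP => ck; rewrite !inE /shift_factor /=.
by case: ifP => _; rewrite xpair_eqE eq_sym ?(negbTE jup) ?(negbTE jdn).
Qed.

Lemma card_shift_factors lam d0 n i y j z :
  0 < d0 -> (forall a : 'I_n, (d0 + a).*2 < s) -> i < s -> j < s ->
  #|[set a : 'I_n * ((bool * bool) * 'I_lam) |
       shift_factor (d0 + a.1) a.2.1 a.2.2 (i, y) == (j, z)]|
  = if d0 <= dist i j < d0 + n then lam else 0.
Proof.
move=> d00 ds si sj.
rewrite (card_pairs1 (fun (a : 'I_n) (b : (bool * bool) * 'I_lam) =>
  shift_factor (d0 + a) b.1 b.2 (i, y) == (j, z))).
under eq_bigr => a _ do rewrite card_shift_factor ?addn_gt0 ?d00 //.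
rewrite -big_mkcond /=; case: ifP => [/andP[h1 h2] | h].
  have lt : dist i j - d0 < n by lia.
  rewrite (big_pred1 (Ordinal lt)) // => a; apply/eqP/eqP => [E | -> /=]; last by lia.
  by apply: val_inj => /=; lia.
by rewrite big_pred0 // => a; have := ltn_ord a; lia.
Qed.

(** The differences and the labels are read off from the factor. *)
Lemma shift_factor_inj lam d c (k : 'I_lam) d' c' (k' : 'I_lam) :
  lam <= 2 ^ (s %/ 2) -> 0 < d -> d.*2 < s -> 0 < d' -> d'.*2 < s ->
  (forall x, vertex s x -> shift_factor d c k x = shift_factor d' c' k' x) ->
  [/\ d = d', c = c' & k = k'].
Proof.
move=> lam2 d0 ds d0' ds' E.
have dd' : d = d'.
  have s0 : 0 < s by lia.
  have shift_dist e c1 k1 : 0 < e -> e.*2 < s ->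
      dist 0 (shift_factor e c1 k1 (0, false)).1 = e.
    move=> e0 es; apply/eqP; rewrite dist_eq //.
      by rewrite /shift_factor; case: ifP => _ /=; rewrite eqxx ?orbT.
    by case: (shift_factor_matching c1 k1 e0 es (x := (0, false))).
  by rewrite -(shift_dist d c k) // E // shift_dist.
subst d'.
have lab i : i < s -> label d c k i = label d c' k' i.
  move=> si; have := E (i, label d c k i) si; rewrite /shift_factor /= eqxx.
  by case: eqP => // _ [] /eqP; rewrite (negbTE (up_neq_down _ _ _)).
have lk (u : 'I_lam) : u < 2 ^ (s %/ 2) by apply: leq_trans (ltn_ord u) lam2.
have cc' : c = c'.
  (* No digit of k or k' reaches i and i + d = s - 1, so that the two
     independent linear forms attached to them agree on c and c'. *)
  pose i := s - d.+1.
  have si : i < s by rewrite /i; lia.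
  have upi : up d i = s.-1 by rewrite /up /i; case: ifP; lia.
  have := lab i si; have := lab (up d i) (up_lt (ltac:(lia) : d <= s) si).
  rewrite /label !(@bit_high (s %/ 2)) // ?upi; try (rewrite /i; lia).
  rewrite !addbF -upi.
  have := shift_color_proper d0 (ltac:(lia) : d.*2 <= s) si.
  have := shift_color_lt3 d i; have := shift_color_lt3 d (up d i).
  move: (shift_color d i) (shift_color d (up d i)).
  by case: c c' {E lab} => [[] []] [[] []] /= [|[|[|]]] // [|[|[|]]].
split=> //; apply: val_inj; apply: (bit_inj (lk k) (lk k')) => i i2.
have := lab i (leq_trans i2 (leq_div _ _)); rewrite /label cc'.
by move=> /addbI.
Qed.

End Shift.

(** * Even order *)

Lemma double_lt_exp2 n : 3 <= n -> 2 * n < 2 ^ n.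
Proof.
elim: n => // n IHn; rewrite leq_eqVlt => /orP[/eqP<- // | n3].
by have := IHn n3; rewrite expnS; lia.
Qed.

Definition antipode (R i : nat) : nat := if i < R then i + R else i - R.

Definition quad_factor (R v : nat) (x : nat * bool) : nat * bool :=
  match v with
  | 0 => (x.1, ~~ x.2)
  | 1 => (antipode R x.1, x.2)
  | _ => (antipode R x.1, ~~ x.2)
  end.

Lemma even_case R lam : 8 <= R -> 2 <= lam <= 2 * R - 1 ->
  exists M : {mset {set {set 'I_(2 * (2 * R))}}},
    [/\ one_factorization lam M, simple_factorization M & indecomposable lam M].
Proof.
move=> R8 /andP[l2 lR]; set s := 2 * R.
have [w wP] : exists w, indecomposable_words lam R w by apply: exists_words; rewrite // l2; lia.
have aK i : i < s -> antipode R (antipode R i) = i.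
  by rewrite /antipode /s; case: (ltnP i R) => h; case: ifP; lia.
have alt i : i < s -> antipode R i < s by rewrite /antipode /s; case: ifP; lia.
have aneq i : i < s -> (antipode R i == i) = false.
  by rewrite /antipode /s; case: ifP; lia.
apply: (@factorization_of_words s R lam w (fun i => if i < R then i else i - R)
  (quad_factor R) ('I_(R - 1) * ((bool * bool) * 'I_lam))%type
  (fun a => shift_factor s (1 + a.1) a.2.1 a.2.2) wP).
- lia.
- by case=> i y; rewrite /vertex /s /=; case: ifP; lia.
- by move=> p pR; exists (p, false); rewrite /vertex /= ?pR //; lia.
- move=> v v3 [i y]; rewrite /vertex /= => si.
  case: v v3 => [|[|[|]]] // _; split; rewrite /= ?negbK ?aK ?alt // xpair_eqE ?aneq ?eqxx //=.
  by case: (y).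
- move=> v [i y]; rewrite /vertex /s /= => v3 si.
  by case: v v3 => [|[|[|]]] // _; rewrite /= /antipode; do 3? case: ifP; lia.
- move=> v v' [i y] v3 v3' si; rewrite /quad_factor /=.
  have ai := aneq i si; move=> /eqP.
  by case: v v' v3 v3' => [|[|[|]]] // [|[|[|]]] // _ _;
    rewrite xpair_eqE ?ai ?[i == _]eq_sym ?ai //=; case: (y); rewrite ?andbF.
- move=> [a [c k]]; apply: shift_factor_matching => //; have := ltn_ord a; rewrite /s /=; lia.
- move=> [a [c k]] [a' [c' k']] E; have := ltn_ord a; have := ltn_ord a' => ha' ha.
  have lam2 : lam <= 2 ^ (s %/ 2).
    have := @double_lt_exp2 R; rewrite (_ : s %/ 2 = R); rewrite /s; lia.
  have [||||/= /addnI/val_inj-> /= -> /= ->//] := shift_factor_inj lam2 _ _ _ _ E;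
    rewrite /s /=; lia.
- move=> [i y] [j z]; rewrite /vertex /= => si sj xy.
  rewrite card_shift_factors //; last by move=> a; have := ltn_ord a; rewrite /s; lia.
  rewrite !xpair_eqE; move: xy; rewrite xpair_eqE.
  have : (antipode R i == j) = (dist s i j == R).
    by rewrite /antipode /dist; case: ifP; rewrite /s in si sj *; lia.
  have : (i == j) = (dist s i j == 0) by rewrite /dist /s in si sj *; lia.
  have : dist s i j <= R by rewrite /dist /s; lia.
  move: (dist s i j) => d dR -> ->.
  case: (posnP d) => [-> | d0] /=.
    have -> : (0 == R) = false by lia.
    by case: (y); case: (z).
  case: (ltngtP d R) => h //=; try lia.
    by have -> : d < 1 + (R - 1) by lia.
  have -> : d < 1 + (R - 1) = false by lia.
  by case: (y); case: (z).
Qed.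

(** * Odd order *)

Definition mate (i : nat) : nat := if odd i then i.+1 else i.-1.

(** For i >= 5 these are the three factors of the copies of K_4 on the vertices
    with i in {5, 6}, {7, 8}, ...  On the ten vertices with i <= 4, each factor
    consists of the edges between both layers at one even i, namely 0, 2, 4, and
    of the two edges between i and i + 1 for the two pairs {i, i + 1} that remain;
    a pair used by two factors is used once with and once without exchanging the
    layers. *)
Definition odd_quad_factor (v : nat) (x : nat * bool) : nat * bool :=
  let: (i, y) := x in
  match v, i with
  | 0, 0 => (0, ~~ y) | 0, 1 => (2, y) | 0, 2 => (1, y)
  | 0, 3 => (4, y) | 0, 4 => (3, y)
  | 0, _ => (i, ~~ y)
  | 1, 0 => (1, y) | 1, 1 => (0, y) | 1, 2 => (2, ~~ y)
  | 1, 3 => (4, ~~ y) | 1, 4 => (3, ~~ y)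
  | 1, _ => (mate i, y)
  | _, 0 => (1, ~~ y) | _, 1 => (0, ~~ y) | _, 2 => (3, y)
  | _, 3 => (2, y) | _, 4 => (4, ~~ y)
  | _, _ => (mate i, ~~ y)
  end.

Definition link (R i : nat) : nat :=
  if i == 0 then 2 * R else if i == 2 * R then 0 else if odd i then i.-1 else i.+1.

(** The rank of the pair {i, link R i} in {4, 5}, {6, 7}, ..., {2R, 0}. *)
Definition link_index (R i : nat) : nat := (if i == 0 then R else i./2) - 2.

(** The two other factors on the edges with difference at most 1.  For i = 1, 2, 3
    they use what the previous factors leave: the edges between both layers at 1
    and at 3, and one of the two ways of joining {2, 3}, and {1, 2}.  Elsewhere they
    join the consecutive components, the pairs {4, 5}, {6, 7}, ..., {2R, 0}, in the
    two possible ways, exchanged on some pairs according to the digits of [k]. *)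
Definition link_factor (R : nat) (t : bool) (k : nat) (x : nat * bool) : nat * bool :=
  let: (i, y) := x in
  match i, t with
  | 1, false => (1, ~~ y) | 2, false => (3, ~~ y) | 3, false => (2, ~~ y)
  | 1, true => (2, ~~ y) | 2, true => (1, ~~ y) | 3, true => (3, ~~ y)
  | _, _ => (link R i, y (+) (t (+) bit k (link_index R i)))
  end.

Lemma link_factor_far R t k i y : i = 0 \/ 4 <= i ->
  link_factor R t k (i, y) = (link R i, y (+) (t (+) bit k (link_index R i))).
Proof. by case: i => [|[|[|[|i]]]] //; case=> // _; case: t. Qed.

Lemma odd_quad_factor_far v i y : 5 <= i ->
  odd_quad_factor v (i, y) =
    match v with 0 => (i, ~~ y) | 1 => (mate i, y) | _ => (mate i, ~~ y) end.
Proof. by case: i => [|[|[|[|[|i]]]]] //; case: v => [|[|]]. Qed.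

Section OddOrder.
Variable R : nat.
Hypothesis R3 : 3 <= R.
Let s := 2 * R + 1.

Lemma link_factor_matching t k : matching s (link_factor R t k).
Proof.
case=> i y; rewrite /vertex /s /= => si.
have far : i = 0 \/ 4 <= i -> [/\ (link_factor R t k (i, y)).1 < 2 * R + 1,
    link_factor R t k (link_factor R t k (i, y)) = (i, y) &
    link_factor R t k (i, y) != (i, y)].
  move=> fi; have fl : link R i = 0 \/ 4 <= link R i.
    by rewrite /link; do 3? case: ifP; lia.
  rewrite (link_factor_far _ _ _ _ fi) link_factor_far //=; split.
  - by rewrite /link; do 3? case: ifP; lia.
  - congr (_, _); first by rewrite /link; do 6? case: ifP; lia.
    have -> : link_index R (link R i) = link_index R i.
      by rewrite /link_index /link; do 6? case: ifP; lia.
    by case: (y); case: t; case: bit.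
  - rewrite xpair_eqE negb_and; apply/orP; left.
    by rewrite /link; do 3? case: ifP; lia.
move: far si; case: i => [|[|[|[|i]]]] far si; try (apply: far; lia);
  by case: t {far}; split=> //=; rewrite ?negbK //; try lia; case: (y).
Qed.

Lemma odd_quad_factor_matching v : v < 3 -> matching s (odd_quad_factor v).
Proof.
move=> v3 [i y]; rewrite /vertex /s => si.
case: (ltnP i 5) => i5.
  case: i v si i5 v3 => [|[|[|[|[|]]]]] // [|[|[|]]] // si _ _;
    by split=> //=; rewrite ?negbK //; try lia; case: (y).
have fm : 5 <= mate i by rewrite /mate; case: ifP; lia.
have mK : mate (mate i) = i by rewrite /mate; do 2 case: ifP; lia.
have ml : mate i < 2 * R + 1 by rewrite /mate; move: si => /=; case: ifP; lia.
have mn : (mate i == i) = false by rewrite /mate; case: ifP; lia.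
rewrite !odd_quad_factor_far //.
case: v v3 => [|[|[|]]] // _; rewrite odd_quad_factor_far // ?negbK ?mK; split=> //;
  by rewrite xpair_eqE ?mn //; case: (y); rewrite ?andbF.
Qed.

Lemma odd_cover k i y j z : i < s -> j < s -> (i, y) != (j, z) ->
  (link_factor R false k (i, y) == (j, z)) + (link_factor R true k (i, y) == (j, z))
  + [|| odd_quad_factor 0 (i, y) == (j, z), odd_quad_factor 1 (i, y) == (j, z)
      | odd_quad_factor 2 (i, y) == (j, z)] = (dist s i j <= 1).
Proof.
rewrite /s => si sj xy.
case: (ltnP i 5) => i5; last first.
  rewrite !odd_quad_factor_far // !link_factor_far; try lia.
  move: xy; rewrite !xpair_eqE.
  have [E | nE] := eqVneq i j.
    subst j => /=.
    have -> : (link R i == i) = false by rewrite /link; do 3? case: ifP; lia.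
    have -> : (mate i == i) = false by rewrite /mate; case: ifP; lia.
    have -> : dist (2 * R + 1) i i = 0 by rewrite /dist; lia.
    by case: (y); case: (z).
  rewrite /= => _.
  have -> : (dist (2 * R + 1) i j <= 1) = (link R i == j) + (mate i == j) :> nat.
    by rewrite /dist /link /mate; do 3? case: ifP; lia.
  have : (link R i == j) + (mate i == j) <= 1.
    by rewrite /link /mate; do 3? case: ifP; lia.
  by case: (link R i == j); case: (mate i == j) => //= _; case: (y); case: (z); case: bit.
case: i i5 si xy => [|[|[|[|[|]]]]] // _ si;
  rewrite ?(link_factor_far _ _ _ _ (or_introl erefl)) /= ?xpair_eqE => xy.
- have -> : (dist (2 * R + 1) 0 j <= 1) = [|| j == 0, j == 1 | j == 2 * R].
    by rewrite /dist; lia.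
  have -> : link R 0 = 2 * R by [].
  case: (eqVneq j 0) xy => [-> | _] /=.
    have -> : (2 * R == 0) = false by lia.
    by case: (y); case: (z).
  case: (eqVneq j 1) => [-> | _] _ /=.
    have -> : (2 * R == 1) = false by lia.
    by case: (y); case: (z).
  by rewrite eq_sym; case: (j == _) => //=; case: bit; case: (y); case: (z).
- have -> : (dist (2 * R + 1) 1 j <= 1) = [|| j == 0, j == 1 | j == 2].
    by rewrite /dist; lia.
  by case: j sj xy => [|[|[|j]]] //= _; case: (y); case: (z).
- have -> : (dist (2 * R + 1) 2 j <= 1) = [|| j == 1, j == 2 | j == 3].
    by rewrite /dist; lia.
  by case: j sj xy => [|[|[|[|j]]]] //= _; case: (y); case: (z).
- have -> : (dist (2 * R + 1) 3 j <= 1) = [|| j == 2, j == 3 | j == 4].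
    by rewrite /dist; lia.
  by case: j sj xy => [|[|[|[|[|j]]]]] //= _; case: (y); case: (z).
- have -> : (dist (2 * R + 1) 4 j <= 1) = [|| j == 3, j == 4 | j == 5].
    by rewrite /dist; lia.
  have -> : link R 4 = 5 by rewrite /link; case: ifP; lia.
  by case: j sj xy => [|[|[|[|[|[|j]]]]]] //= _; case: bit; case: (y); case: (z).
Qed.

Lemma link_factor_inj t t' k k' : k < 2 ^ (R - 1) -> k' < 2 ^ (R - 1) ->
  (forall x, vertex s x -> link_factor R t k x = link_factor R t' k' x) ->
  t = t' /\ k = k'.
Proof.
move=> lk lk' E.
have tt' : t = t'.
  have := E (1, false); rewrite /vertex /s /= => /(_ ltac:(lia)).
  by case: t t' {E} => [] [].
split=> //; apply: (bit_inj lk lk') => m mR.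
have vm : vertex s (2 * m.+2, false) by rewrite /vertex /s /=; lia.
have := E _ vm; rewrite !link_factor_far; try lia.
have m0 : (2 * m.+2 == 0) = false by lia.
have -> : link_index R (2 * m.+2) = m by rewrite /link_index m0; lia.
by rewrite tt' => -[]; rewrite /= => /addbI.
Qed.

End OddOrder.

Lemma odd_case R lam : 9 <= R -> 2 <= lam <= 2 * R - 1 ->
  exists M : {mset {set {set 'I_(2 * (2 * R + 1))}}},
    [/\ one_factorization lam M, simple_factorization M & indecomposable lam M].
Proof.
move=> R9 /andP[l2 lR]; set s := 2 * R + 1.
have [w wP] : exists w, indecomposable_words lam (R - 1) w.
  by apply: exists_words; rewrite ?l2 /=; lia.
have R3 : 3 <= R by lia.
have le2 : lam <= 2 ^ (R - 1) by have := @double_lt_exp2 (R - 1) ltac:(lia); lia.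
pose f (a : ('I_(R - 1) * ((bool * bool) * 'I_lam)) + (bool * 'I_lam)) :=
  match a with
  | inl b => shift_factor s (2 + b.1) b.2.1 b.2.2
  | inr b => link_factor R b.1 b.2
  end.
apply: (@factorization_of_words s (R - 1) lam w
  (fun i => if i < 5 then 0 else (i - 3)./2) odd_quad_factor _ f wP).
- lia.
- by case=> i y; rewrite /vertex /s /=; case: ifP; lia.
- move=> p pR; exists (if p == 0 then 0 else 2 * p + 3, false); rewrite /vertex /s /=.
    by case: ifP; lia.
  by do 2? case: ifP; lia.
- by move=> v v3; apply: odd_quad_factor_matching.
- move=> v [i y] v3; rewrite /vertex /s => si; case: (ltnP i 5) => i5.
    by move: i5; case: (i) => [|[|[|[|[|]]]]] // _; case: v v3 => [|[|[|]]].
  rewrite odd_quad_factor_far //; case: v v3 => [|[|[|]]] // _ /=;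
    by rewrite /mate; do 5? case: ifP; lia.
- move=> v v' [i y] v3 v3' _; case: (ltnP i 5) => i5.
    by case: i i5 => [|[|[|[|[|]]]]] // _; case: v v' v3 v3' => [|[|[|]]] // [|[|[|]]] // _ _ [];
      case: (y).
  rewrite !odd_quad_factor_far // => /eqP.
  have mi : (mate i == i) = false by rewrite /mate; case: ifP; lia.
  by case: v v' v3 v3' => [|[|[|]]] // [|[|[|]]] // _ _;
    rewrite xpair_eqE ?mi ?[i == _]eq_sym ?mi //=; case: (y); rewrite ?andbF.
- case=> [[a [c k]] | [t k]] /=; last exact: link_factor_matching.
  by apply: shift_factor_matching => //; have := ltn_ord a; rewrite /s /=; lia.
- (* At i = 0 a link factor has difference 1. *)
  have inl_inr a c k t k' : ~ (forall x, vertex s x ->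
      shift_factor s (2 + val (a : 'I_(R - 1))) c k x = link_factor R t k' x).
    have v0 : vertex s (0, false) by rewrite /vertex /s /=; lia.
    move=> /(_ _ v0); rewrite link_factor_far; last by left.
    have := ltn_ord a; rewrite /shift_factor /up /down /link /= => la.
    by case: ifP => _ [] + _; do 1? case: ifP; rewrite /s; lia.
  case=> [[a [c k]] | [t k]] [[a' [c' k']] | [t' k']] E.
  + have := ltn_ord a; have := ltn_ord a' => ha' ha.
    have lam2 : lam <= 2 ^ (s %/ 2).
      by apply: leq_trans le2 _; rewrite leq_exp2l // /s; lia.
    have [||||/= /addnI/val_inj-> /= -> /= ->//] := shift_factor_inj lam2 _ _ _ _ E;
      rewrite /s /=; lia.
  + by case: (inl_inr a c k t' k').
  + by case: (inl_inr a' c' k' t k) => x /E.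
  + have lk (u : 'I_lam) : u < 2 ^ (R - 1) by apply: leq_trans (ltn_ord u) le2.
    by have [/= -> /= /val_inj->] := link_factor_inj R3 (lk k) (lk k') E.
- move=> [i y] [j z]; rewrite /vertex /= => si sj xy.
  rewrite card_sum_type /= card_shift_factors //; last first.
    by move=> a; have := ltn_ord a; rewrite /s; lia.
  rewrite (card_pairs2 (fun t (k : 'I_lam) => link_factor R t k (i, y) == (j, z))).
  have dR : dist s i j <= R by rewrite /dist /s; lia.
  set g := [|| _, _ | _].
  under eq_bigr => k _.
    rewrite card_set_sum big_bool /= addnC.
    have := odd_cover R3 k si sj xy; rewrite -/g => /(canRL (addnK _)) ->.
    over.
  rewrite sum_nat_const card_ord.
  case: (leqP (dist s i j) 1) => h.
    by case: g; rewrite /= ?muln0 ?muln1.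
  have -> : dist s i j < 2 + (R - 1) by lia.
  have -> : g = false.
    by have := odd_cover R3 0 si sj xy; rewrite -/g leqNgt h; case: g => //; rewrite addn1.
  by rewrite /= muln0 addn0.
Qed.

Theorem theorem2 (s : nat) (hs : 18 <= s) (lambda : nat)
    (hlambda : 2 <= lambda <= 2 * (s %/ 2) - 1) :
  exists M : {mset {set {set 'I_(2 * s)}}},
    [/\ one_factorization lambda M,
        simple_factorization M
      & indecomposable lambda M].
Proof.
have R9 : 9 <= s %/ 2 by lia.
have [sE | sE] : s = 2 * (s %/ 2) \/ s = 2 * (s %/ 2) + 1 by lia.
  move: hlambda R9; move: (s %/ 2) sE => R -> lR R9.
  by apply: even_case lR; lia.
move: hlambda R9; move: (s %/ 2) sE => R -> lR R9.
exact: odd_case R9 lR.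
Qed.
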